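(* Let $f:\mathbb{R}^n\to\mathbb{R}^n$ be a locally Lipschitz vector field and consider the system $\dot{x}=f(x)$, $x\in\mathbb{R}^n$. Let $\Omega\subseteq\mathbb{R}^n$ be a compact set that is positively invariant for the system. Suppose that there exist a non-empty set $A\subseteq\mathbb{R}^n$ and a function $V\in C^1(S)$ with $\Omega\setminus A\subseteq S$ such that the following properties hold: (i) $\nabla V(x)f(x)\neq 0$ for all $x\in\Omega\setminus A$; (ii) the set $A$ is negatively invariant for the system. Let $M\subseteq\bar{A}\cap\Omega$ be the largest invariant set for the system in $\bar{A}\cap\Omega$, where $\bar{A}$ is the closure of $A$. Then the inclusion $\omega(x_0)\subseteq M$ holds for every $x_0\in\Omega$.
   Context: For $x_0\in\mathbb{R}^n$, $\phi(t,x_0)$ denotes the unique solution at time $t\geq 0$ of $\dot{x}=f(x)$ with $x(0)=x_0$, defined on its maximal forward interval $[0,t_{\max}(x_0))$, $t_{\max}(x_0)\in(0,+\infty]$. A non-empty set $B\subseteq\mathbb{R}^n$ is positively invariant if for every $x_0\in B$ it holds that $\phi(t,x_0)\in B$ for all $t\in[0,t_{\max}(x_0))$. A non-empty set $B\subseteq\mathbb{R}^n$ is negatively invariant if the following implication holds: if $\phi(t,x_0)\in B$ for certain $x_0\in\mathbb{R}^n$ and $t\in[0,t_{\max}(x_0))$, then $x_0\in B$. A set is invariant if it is both positively and negatively invariant. The largest invariant set in a set $B$ is the union of all invariant sets contained in $B$. The $\omega$-limit set of $x_0$ is $\omega(x_0)=\{y\in\mathbb{R}^n:\exists\{t_k\geq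 0:k=1,2,\ldots\}\text{ with }\lim_{k\to+\infty}t_k=+\infty\text{ and }\lim_{k\to+\infty}\phi(t_k,x_0)=y\}$. The class $C^1(S)$: here $S\subseteq\mathbb{R}^n$ is a set for which there is a non-empty open set $D\subseteq\mathbb{R}^n$ with $D\subseteq S\subseteq\bar{D}$. $C^0(S)$ is the class of continuous real-valued functions on $S$; $C^1(S)$ is the class of real-valued functions on $S$ which have continuous first-order derivatives, meaning that the functions have continuous first-order derivatives in $D$ that can be continued continuously to all points in $S$. $\nabla V(x)$ is the gradient (as a row vector), so $\nabla V(x)f(x)$ is the scalar product of the gradient with $f(x)$; at points of $S\setminus D$, $\nabla V$ is given by this continuous extension.
   Formalization: At points x of S∖D the continued gradient is additionally required to be the derivative of V on S: V(y)=V(x)+∇V(x)(y−x)+o(|y−x|) as y→x in S; without this the claim fails (rotation on the unit circle, A={0}, V the polar angle on a slit annulus). *)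

(* Defs.v *)
From HB Require Import structures.
From mathcomp Require Import all_boot all_order all_algebra.
From mathcomp Require Import all_classical all_reals all_analysis.

Set Implicit Arguments.
Unset Strict Implicit.
Unset Printing Implicit Defensive.

Import Order.TTheory GRing.Theory Num.Theory.
Import numFieldNormedType.Exports.

Local Open Scope classical_set_scope.
Local Open Scope ring_scope.

(* Points of R^n are row vectors; the topology is the one of the sup norm. *)

Definition locally_lipschitz (R : realType) (n : nat)
    (f : 'rV[R]_n -> 'rV[R]_n) : Prop :=
  forall x : 'rV[R]_n, exists2 U : set 'rV[R]_n, nbhs x U & [lipschitz f y | y in U].

(* The derivative at the left end point 0 of [0, T[ is one-sided. The values
   of x outside [0, T[ are irrelevant. *)
Definition solution_on (R : realType) (n : nat) (f : 'rV[R]_n -> 'rV[R]_n)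
    (x0 : 'rV[R]_n) (T : \bar R) (x : R -> 'rV[R]_n) : Prop :=
  [/\ x 0 = x0,
      (h^-1 *: (x h - x 0) @[h --> 0^'+] --> f (x 0)) &
      forall t : R, 0 < t -> (t%:E < T)%E -> is_derive t 1 x (f (x t))].

(* For locally Lipschitz f, solutions on [0, T[ and [0, T'[ with the same
   initial value agree on the overlap, so the supremum is the length of the
   maximal forward interval. *)
Definition tmax (R : realType) (n : nat) (f : 'rV[R]_n -> 'rV[R]_n)
    (x0 : 'rV[R]_n) : \bar R :=
  ereal_sup [set T : \bar R | (0 < T)%E /\ exists x, solution_on f x0 T x].

(* phi f t x0 is meaningful only for 0 <= t < tmax f x0, where it is the value
   at time t of the unique maximal solution; the default cst 0 of xget is never
   used when f is locally Lipschitz. *)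
Definition phi (R : realType) (n : nat) (f : 'rV[R]_n -> 'rV[R]_n)
    (t : R) (x0 : 'rV[R]_n) : 'rV[R]_n :=
  xget (cst 0 : R -> 'rV[R]_n)
    [set x : R -> 'rV[R]_n | solution_on f x0 (tmax f x0) x] t.

Definition positively_invariant (R : realType) (n : nat)
    (f : 'rV[R]_n -> 'rV[R]_n) (B : set 'rV[R]_n) : Prop :=
  B !=set0 /\
  forall (x0 : 'rV[R]_n) (t : R),
    B x0 -> 0 <= t -> (t%:E < tmax f x0)%E -> B (phi f t x0).

Definition negatively_invariant (R : realType) (n : nat)
    (f : 'rV[R]_n -> 'rV[R]_n) (B : set 'rV[R]_n) : Prop :=
  B !=set0 /\
  forall (x0 : 'rV[R]_n) (t : R),
    0 <= t -> (t%:E < tmax f x0)%E -> B (phi f t x0) -> B x0.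

Definition invariant_set (R : realType) (n : nat)
    (f : 'rV[R]_n -> 'rV[R]_n) (B : set 'rV[R]_n) : Prop :=
  positively_invariant f B /\ negatively_invariant f B.

Definition largest_invariant_set (R : realType) (n : nat)
    (f : 'rV[R]_n -> 'rV[R]_n) (B : set 'rV[R]_n) : set 'rV[R]_n :=
  \bigcup_(I in [set I | invariant_set f I /\ I `<=` B]) I.

(* Writing phi f (t k) x0 presupposes t k < tmax f x0; hence the set is empty
   when tmax f x0 is finite. *)
Definition omega_limit_set (R : realType) (n : nat)
    (f : 'rV[R]_n -> 'rV[R]_n) (x0 : 'rV[R]_n) : set 'rV[R]_n :=
  [set y | exists t : R^nat,
    [/\ forall k, 0 <= t k /\ ((t k)%:E < tmax f x0)%E,
        t @ \oo --> +oo &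
        phi f (t k) x0 @[k --> \oo] --> y]].

Definition dotv (R : realType) (n : nat) (u v : 'rV[R]_n) : R :=
  (u *m v^T) 0 0.

(* C1_on D S V gradV: V is of class C^1(S), D being the open set with
   D <= S <= closure D, and gradV is its gradient on S. Only the values of V
   and gradV on S matter, and gradV is determined there since D is dense in S.
   The first-order derivatives of V exist in D and gradV is their continuous
   continuation to S. At a point x of S \ D the continued gradient is required
   to be the derivative of the function V on S, i.e.
     V y = V x + gradV x (y - x) + o(|y - x|)   as y -> x within S;
   at points of D the corresponding expansion follows from the continuity of
   the partial derivatives. This does not follow from the mere existence of
   the continuous continuation, even for V continuous on S: let C be the Cantor
   set, c the Cantor function, S the union of the unit circle and of
   D = {(r, theta) | 1 < r < 2, theta / 2pi \notin C}, and
   V = theta - 2pi * c (theta / 2pi). Then V is continuous on S and the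
   gradient of V on D is that of theta, but V takes the same value 0 at both
   ends of a turn around the circle. *)
Definition C1_on (R : realType) (n : nat) (D S : set 'rV[R]_n)
    (V : 'rV[R]_n -> R) (gradV : 'rV[R]_n -> 'rV[R]_n) : Prop :=
  [/\ D !=set0 /\ open D,
      D `<=` S /\ S `<=` closure D,
      forall x, D x -> forall i : 'I_n,
        is_derive x (delta_mx 0 i : 'rV[R]_n) V (gradV x 0 i),
      {within S, continuous gradV} &
      forall x, (S `\` D) x -> forall e : R, 0 < e ->
        \forall y \near within S (nbhs x),
          `|V y - V x - dotv (gradV x) (y - x)| <= e * `|y - x|].

(* Main.v *)
(* Since A is negatively invariant, a trajectory in Omega either lies in A
   forever, and then its omega-limit set lies in the closure of A, or stays in
   Omega \ A from some time on. In the second case t |-> V (x t) has a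
   continuous nonvanishing derivative, so it is strictly monotone. If y is an
   omega-limit point outside the closure of A, then V (x (t k)) tends to V y,
   whereas grad V . f is bounded away from 0 near y and the speed of x is
   bounded, so V (x t) changes by a fixed amount after each late enough t k, a
   contradiction. The omega-limit set is itself invariant by Gronwall's
   inequality on a compact set, used forwards and backwards in time; no
   existence theorem for solutions is needed. *)

Require Import Defs.
From HB Require Import structures.
From mathcomp Require Import all_boot all_order all_algebra.
From mathcomp Require Import all_classical all_reals all_analysis.
From mathcomp Require Import ring lra.

Import Order.TTheory GRing.Theory Num.Theory.
Import numFieldNormedType.Exports.

Local Open Scope classical_set_scope.
Local Open Scope ring_scope.
Set Implicit Arguments.
Unset Strict Implicit.
Unset Printing Implicit Defensive.

(** * Local and uniform Lipschitz bounds *)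

Lemma locally_lipschitz_continuous (R : realType) (n : nat)
    (f : 'rV[R]_n -> 'rV[R]_n) : locally_lipschitz f -> continuous f.
Proof.
move=> hf x; have [U Ux [M [Mreal HM]]] := hf x.
have {}HM : forall y, U y -> `|f x - f y| <= (`|M| + 1) * `|x - y|.
  move=> y Uy; apply: (HM (`|M| + 1) _ (x, y)).
    by rewrite (le_lt_trans (ler_norm M))// ltrDl.
  by split => //=; exact: nbhs_singleton.
apply/(@cvgrPdist_le _ _ _ (nbhs x)) => e e0.
have M0 : 0 < `|M| + 1 by rewrite ltr_wpDl.
near=> y; apply: le_trans (HM y _) _; first by near: y.
rewrite -ler_pdivlMl//.
near: y; apply: (@cvgr_dist_le _ _ _ (nbhs x) _ id) => //.
by rewrite mulr_gt0// invr_gt0.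
Unshelve. all: by end_near. Qed.

(** Compactness is applied to the product [K * K]. Near a diagonal point a local Lipschitz constant
    works; near a point [(x, y)] off the diagonal [|p - q|] is bounded below and [|f p - f q|]
    above, so every large [L] works. *)
Lemma locally_lipschitz_compact (R : realType) (n : nat)
    (f : 'rV[R]_n -> 'rV[R]_n) (K : set 'rV[R]_n) :
  locally_lipschitz f -> compact K ->
  exists2 L, 0 < L & {in K &, forall x y, `|f x - f y| <= L * `|x - y|}.
Proof.
move=> hf cK; have cf := locally_lipschitz_continuous hf.
have /compact_near_coveringP cKK := compact_setX cK cK.
pose P (L : R) (p : 'rV[R]_n * 'rV[R]_n) :=
  `|f p.1 - f p.2| <= L * `|p.1 - p.2|.
have KL : \forall L \near +oo, K `*` K `<=` P L.
  apply: cKK => -[x y] /= [Kx Ky].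
  have [xy|xy] := eqVneq x y.
    have [U Ux [M [Mreal HM]]] := hf x.
    exists (U `*` U, [set L | M < L]).
      by split; [exists (U, U) => //; rewrite -xy | exact: nbhs_pinfty_gt].
    by move=> [[p q] L] /= [[Up Uq] ML]; apply: (HM L ML (p, q)).
  (* With a quarter of the distance, points [d]-close to [x] and to [y] remain at least [2 * d]
     apart. *)
  pose d := `|x - y| / 4.
  have d0 : 0 < d by rewrite divr_gt0// normr_gt0 subr_eq0.
  pose N (z : 'rV[R]_n) := [set p | `|z - p| < d /\ `|f z - f p| < 1].
  have NN z : nbhs z (N z).
    apply: (@filterI _ (nbhs z)).
      exact: (@cvgr_dist_lt _ _ _ (nbhs z) _ id).
    by apply: (@cvgr_dist_lt _ _ _ (nbhs z) _ f) => //; exact: cf.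
  (* The numerator bounds [|f p - f q|] on [N x * N y], and [d] bounds [|p - q|] from below
     there. *)
  pose c := (`|f x - f y| + 2) / d.
  exists (N x `*` N y, [set L | c < L]).
    by split; [exists (N x, N y) | exact/nbhs_pinfty_gt/num_real].
  move=> [[p q] L] /= [[[xp fxp] [yq fyq]] cL]; rewrite /P /=.
  have fpq : `|f p - f q| <= `|f x - f y| + 2.
    rewrite (_ : f p - f q = (f x - f y) - (f x - f p) + (f y - f q)).
      rewrite (le_trans (ler_normD _ _))//.
      by rewrite (le_trans (lerD (ler_normB _ _) (lexx _)))//; lra.
    by apply/rowP => i; rewrite !mxE; ring.
  have pqd : d <= `|p - q|.
    have : `|x - y| <= `|x - p| + `|p - q| + `|y - q|.
      rewrite (_ : x - y = (x - p) + (p - q) - (y - q)).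
        by rewrite (le_trans (ler_normB _ _))// lerD2r ler_normD.
      by apply/rowP => i; rewrite !mxE; ring.
    by rewrite /d in xp yq d0 *; lra.
  apply: le_trans fpq _; have : c * d <= L * `|p - q|.
    by rewrite ler_pM// ?ltW// /c divr_gt0// ltr_wpDl.
  by rewrite /c divfK// gt_eqF.
have [L [L0 PL]] : exists L : R, 0 < L /\ K `*` K `<=` P L.
  exact: (@filter_ex _ (pinfty_nbhs R) _ _ (filterI (nbhs_pinfty_gt (num_real 0)) KL)).
by exists L => // x y; rewrite !inE => Kx Ky; exact: (PL (x, y)).
Qed.

(** * Gronwall estimates in both time directions *)

(** The bound on [|dE|] makes [E t * expR (- c * t)] nonincreasing, which serves for [s <= t], and
    [E t * expR (c * t)] nondecreasing, which serves for [t <= s]. The sign of [E s] allows the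
    exponent [c * |t - s|] to be enlarged to [c * (b - a)]. *)
Lemma gronwall_real (R : realType) (E dE : R -> R) (c a b : R) :
  0 <= c -> (forall t, t \in `]a, b[ -> is_derive t 1 E (dE t)) ->
  {within `[a, b], continuous E} ->
  (forall t, t \in `]a, b[ -> `|dE t| <= c * E t) ->
  {in `[a, b] &, forall s t, 0 <= E s -> E t <= expR (c * (b - a)) * E s}.
Proof.
move=> c0 dEt cE Ec s t /[!in_itv]/= /andP[as_ sb] /andP[at_ tb] Es0.
have dexp (k r : R) : is_derive r 1 (fun u => expR (k * u)) (k * expR (k * r)).
  have -> : (fun u => expR (k * u)) = expR \o ( *%R k) by [].
  apply: is_derive_eq.
  by rewrite /GRing.scale/= mulr1 mulrC.
have cexp (k : R) : continuous (fun u => expR (k * u)).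
  move=> u; apply: (@continuous_comp _ _ _ ( *%R k) expR).
    exact: mulrl_continuous.
  exact: continuous_expR.
have dP (k : R) r : r \in `]a, b[ ->
  is_derive r 1 (fun u => E u * expR (k * u)) ((dE r + k * E r) * expR (k * r)).
  move=> /dEt dEr; apply: is_derive_eq.
  by rewrite /GRing.scale/=; ring.
have cP (k : R) : {within `[a, b], continuous (fun u => E u * expR (k * u))}.
  have ck : {within `[a, b], continuous (fun u : R => expR (k * u))}.
    exact/continuous_subspaceT/cexp.
  by move=> r; exact: (@continuousM _ (subspace `[a, b]) _ _ r (cE r) (ck r)).
have le_exp (k : R) : k <= c * (b - a) -> E s * expR k <= expR (c * (b - a)) * E s.
  by move=> kc; rewrite mulrC ler_wpM2r// ler_expR.
have [st|/ltW ts] := leP s t.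
- have H : E t * expR (- c * t) <= E s * expR (- c * s).
    apply: (@ler0_derive1_le_cc _ (fun u => E u * expR (- c * u)) a b _ _ (cP _));
      rewrite ?in_itv/= ?as_ ?at_ ?sb ?tb//.
      by move=> r /(dP (- c)) [].
    move=> r rab; have [_] := dP (- c) r rab; rewrite derive1E => ->.
    by rewrite pmulr_lle0 ?expR_gt0// mulNr subr_le0 (le_trans (ler_norm _))// Ec.
  apply: le_trans (le_exp (c * (t - s)) _); last by rewrite ler_wpM2l// lerB.
  move: H; rewrite mulNr expRN ler_pdivrMr ?expR_gt0// -mulrA -expRD.
  by rewrite mulNr addrC -mulrBr.
- have H : E t * expR (c * t) <= E s * expR (c * s).
    apply: (@ger0_derive1_le_cc _ (fun u => E u * expR (c * u)) a b _ _ (cP _));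
      rewrite ?in_itv/= ?as_ ?at_ ?sb ?tb//.
      by move=> r /(dP c) [].
    move=> r rab; have [_] := dP c r rab; rewrite derive1E => ->.
    rewrite pmulr_lge0 ?expR_gt0//; move: (Ec _ rab); rewrite ler_norml => /andP[].
    by rewrite lerNl addrC -subr_ge0 opprK.
  apply: le_trans (le_exp (c * (s - t)) _); last by rewrite ler_wpM2l// lerB.
  by move: H; rewrite -ler_pdivlMr ?expR_gt0// -expRN -mulrA -expRD -mulrBr.
Qed.

Lemma ler_norm_coord (R : realType) (n : nat) (v : 'rV[R]_n) (i : 'I_n) :
  `|v 0 i| <= `|v|.
Proof. by rewrite [leRHS]/Num.Def.normr/= mx_normrE (le_bigmax _ _ (0, i)). Qed.

Lemma ler_norm_rV (R : realType) (n : nat) (v : 'rV[R]_n) (e : R) :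
  0 <= e -> (forall i, `|v 0 i| <= e) -> `|v| <= e.
Proof.
move=> e0 ve; rewrite [leLHS]/Num.Def.normr/= mx_normrE bigmax_le// => -[i j] _.
by rewrite ord1; exact: ve.
Qed.

Lemma is_derive_coord (R : realType) (n : nat) (x : R -> 'rV[R]_n) (t : R)
    (v : 'rV[R]_n) (i : 'I_n) :
  is_derive t 1 x v -> is_derive t 1 (fun s => x s 0 i) (v 0 i).
Proof.
move=> [dx <-]; rewrite derive_mx// mxE.
by apply: derivableP; exact: (derivable_mxP x t 1).1.
Qed.

(** Together with the next lemma this compares the sup norm with the Euclidean energy. The square
    root of the sum dominates every coordinate, hence the sup norm. *)
Lemma sqnorm_le_sum (R : realType) (n : nat) (v : 'rV[R]_n) :
  `|v| ^+ 2 <= \sum_i v 0 i ^+ 2.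
Proof.
have S0 : 0 <= \sum_i v 0 i ^+ 2 by apply: sumr_ge0 => i _; exact: sqr_ge0.
rewrite -[leRHS]sqr_sqrtr// lerXn2r ?nnegrE ?sqrtr_ge0//.
apply: ler_norm_rV => [|i]; first exact: sqrtr_ge0.
rewrite -sqrtr_sqr ler_sqrt// (bigD1 i)//= lerDl.
by apply: sumr_ge0 => j _; exact: sqr_ge0.
Qed.

Lemma sum_le_sqnorm (R : realType) (n : nat) (v : 'rV[R]_n) :
  \sum_i v 0 i ^+ 2 <= n%:R * `|v| ^+ 2.
Proof.
have -> : n%:R * `|v| ^+ 2 = \sum_(i < n) `|v| ^+ 2.
  by rewrite sumr_const card_ord mulr_natl.
apply: ler_sum => i _.
by rewrite -real_normK ?num_real// lerXn2r ?nnegrE// ler_norm_coord.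
Qed.

(* The proof uses the Euclidean energy because, unlike the sup norm, it is
   differentiable along solutions. The estimate holds in both time directions. *)
Lemma gronwall (R : realType) (n : nat) (f : 'rV[R]_n -> 'rV[R]_n)
    (K : set 'rV[R]_n) (L l : R) :
  0 <= L -> {in K &, forall x y, `|f x - f y| <= L * `|x - y|} ->
  exists2 C, 0 < C & forall (x w : R -> 'rV[R]_n) (a b : R), b - a = l ->
    {within `[a, b], continuous x} -> {within `[a, b], continuous w} ->
    (forall t, t \in `]a, b[ -> is_derive t 1 x (f (x t))) ->
    (forall t, t \in `]a, b[ -> is_derive t 1 w (f (w t))) ->
    (forall t, t \in `[a, b] -> K (x t) /\ K (w t)) ->
    {in `[a, b] &, forall s t, `|x t - w t| <= C * `|x s - w s|}.
Proof.
(* Each of the [n] terms of the derivative of the energy is at most [2 * L * |x - w| ^ 2], and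
   [|x - w| ^ 2] is at most the energy. *)
move=> L0 fL; pose c := 2 * n%:R * L.
have c0 : 0 <= c by rewrite !mulr_ge0.
pose C := n%:R * expR (c * l).
have C0 : 0 <= C by rewrite mulr_ge0// expR_ge0.
(* Adding 1 keeps the constant positive even for [n = 0], and [C <= (C + 1) ^ 2] turns the estimate
   of the squares into one of the norms. *)
exists (C + 1); first by rewrite ltr_wpDl.
move=> x w a b abl cx cw dx dw Kxw s t sab tab.
pose E (u : R) := \sum_i (x u - w u) 0 i ^+ 2.
pose dE (u : R) := \sum_i 2 * (x u - w u) 0 i * (f (x u) - f (w u)) 0 i.
have E0 u : 0 <= E u by apply: sumr_ge0 => i _; exact: sqr_ge0.
have Edist : E t <= expR (c * l) * E s.
  rewrite -abl; apply: (@gronwall_real _ E dE) => //.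
  - move=> u uab.
    have -> : E = \sum_i (fun u => (x u - w u) 0 i ^+ 2).
      by apply/funext => r; rewrite fct_sumE.
    apply: is_derive_sum => i.
    have di : is_derive u 1 (fun u => (x u - w u) 0 i) ((f (x u) - f (w u)) 0 i).
      by apply: is_derive_coord; apply: is_deriveB; [exact: dx|exact: dw].
    have -> : (fun u => (x u - w u) 0 i ^+ 2) = (fun u => (x u - w u) 0 i) ^+ 2.
      by apply/funext => r; rewrite exprfctE.
    apply: is_derive_eq; rewrite /GRing.scale/=; ring.
  - have cd i : {within `[a, b], continuous (fun u => (x u - w u) 0 i)}.
      move=> u; have cxw := @continuousB _ _ (subspace `[a, b]) _ _ u (cx u) (cw u).
      exact: (@continuous_comp (subspace `[a, b]) _ _ _ (fun v : 'rV[R]_n => v 0 i) u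
        cxw (@coord_continuous _ _ _ _ _ _)).
    apply: (@continuous_big _ _ +%R 0 predT add_continuous (subspace `[a, b])
      (index_enum 'I_n) (fun i u => (x u - w u) 0 i ^+ 2)) => i _ u.
    exact: (@continuousM _ (subspace `[a, b]) _ _ u (cd i u) (cd i u)).
  - move=> u uab.
    have [/mem_set Kx /mem_set Kw] := Kxw u (subset_itv_oo_cc uab).
    apply: le_trans (_ : c * `|x u - w u| ^+ 2 <= _); last first.
      by rewrite ler_wpM2l// sqnorm_le_sum.
    rewrite (le_trans (ler_norm_sum _ _ _))//.
    have -> : c * `|x u - w u| ^+ 2 = \sum_(i < n) (2 * L * `|x u - w u| ^+ 2).
      by rewrite sumr_const card_ord -[RHS]mulr_natl /c; ring.
    apply: ler_sum => i _; rewrite !normrM ger0_norm// expr2 mulrA -!mulrA ler_wpM2l//.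
    rewrite [leRHS](_ : _ = `|x u - w u| * (L * `|x u - w u|)); last by ring.
    by rewrite ler_pM// ?ler_norm_coord// (le_trans (ler_norm_coord _ _))// fL.
have : `|x t - w t| ^+ 2 <= ((C + 1) * `|x s - w s|) ^+ 2.
  rewrite (le_trans (sqnorm_le_sum _))// (le_trans Edist)//.
  apply: le_trans (_ : expR (c * l) * (n%:R * `|x s - w s| ^+ 2) <= _).
    by rewrite ler_wpM2l ?expR_ge0// sum_le_sqnorm.
  rewrite mulrA (mulrC (expR _)) -/C exprMn ler_wpM2r ?sqr_ge0//.
  by nra.
by rewrite ler_pXn2r// nnegrE ?normr_ge0// mulr_ge0// addr_ge0.
Qed.

(** * Uniqueness of solutions and the maximal flow *)

Lemma ereal_lt_between (R : realType) (t : R) (T : \bar R) :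
  (t%:E < T)%E -> exists2 u : R, t < u & (u%:E < T)%E.
Proof.
case: T => [r||//]; last by exists (t + 1); rewrite ?ltrDl// ltry.
by rewrite lte_fin => tr; exists ((t + r) / 2); rewrite ?lte_fin midf_lt.
Qed.

Lemma solution_within_continuous (R : realType) (n : nat)
    (f : 'rV[R]_n -> 'rV[R]_n) (x0 : 'rV[R]_n) (T : \bar R) (x : R -> 'rV[R]_n)
    (b : R) :
  solution_on f x0 T x -> 0 <= b -> (b%:E < T)%E -> {within `[0, b], continuous x}.
Proof.
(* The interval is enlarged to [[0, c]], which is nondegenerate even when [b = 0]. *)
move=> [_ dx0 dx] b0 /ereal_lt_between[c bc cT].
have c0 : 0 < c by exact: le_lt_trans bc.
apply: (@continuous_subspaceW _ _ `[0, b] `[0, c]).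
  by apply: subset_itvl; rewrite bnd_simp ltW.
have dcx t : 0 < t -> t <= c -> {for t, continuous x}.
  move=> t0 tc; apply/differentiable_continuous/derivable1_diffP.
  by have [|//] := dx t t0 _; rewrite (le_lt_trans _ cT)// lee_fin.
apply/continuous_within_itvP => //; split.
- by move=> t; rewrite in_itv/= => /andP[t0 /ltW]; exact: dcx.
(* Right continuity at 0: the increment of [x] is [h] times a convergent difference quotient. *)
- have : h *: (h^-1 *: (x h - x 0)) + x 0 @[h --> 0^'+] --> 0 *: f (x 0) + x 0.
    apply: cvgD; last exact: cvg_cst.
    by apply: cvgZ => //; apply: cvg_within_filter; exact: cvg_id.
  rewrite scale0r add0r; apply: cvg_trans; apply: near_eq_cvg.
  near=> h; rewrite scalerA divff ?scale1r ?subrK// gt_eqF//.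
- by apply: cvg_at_left_filter; exact: dcx.
Unshelve. all: by end_near. Qed.

(** Gronwall on the compact union of the two arcs, starting from distance 0. *)
Lemma solution_unique (R : realType) (n : nat) (f : 'rV[R]_n -> 'rV[R]_n)
    (x0 : 'rV[R]_n) (T T' : \bar R) (x w : R -> 'rV[R]_n) (t : R) :
  locally_lipschitz f -> solution_on f x0 T x -> solution_on f x0 T' w ->
  0 <= t -> (t%:E < T)%E -> (t%:E < T')%E -> x t = w t.
Proof.
move=> hf sx sw t0 tT tT'.
have cx := solution_within_continuous sx t0 tT.
have cw := solution_within_continuous sw t0 tT'.
pose K := x @` `[0, t] `|` w @` `[0, t].
have cK : compact K.
  by apply: compactU; apply: continuous_compact => //; exact: segment_compact.
have [L /ltW L0 fL] := locally_lipschitz_compact hf cK.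
have [C _ /(_ x w 0 t)] := gronwall t L0 fL.
rewrite subr0 => /(_ erefl cx cw).
have [x00 _ dx] := sx; have [w00 _ dw] := sw.
move=> /(_ _ _ _ 0 t); rewrite x00 w00 subrr normr0 mulr0 normr_le0 subr_eq0.
move=> H; apply/eqP/H; rewrite ?in_itv/= ?t0 ?lexx//.
- by move=> u; rewrite in_itv/= => /andP[u0 ut]; apply: dx => //; exact: lt_trans tT.
- by move=> u; rewrite in_itv/= => /andP[u0 ut]; apply: dw => //; exact: lt_trans tT'.
- by move=> u ut; split; [left|right]; exists u.
Qed.

(** The case [s = 0] is separate because only a one-sided derivative is given there; for [s > 0] the
    two-sided derivative at [s] yields the one-sided one required at the new origin. *)
Lemma solution_shift (R : realType) (n : nat) (f : 'rV[R]_n -> 'rV[R]_n)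
    (x0 : 'rV[R]_n) (x : R -> 'rV[R]_n) (s : R) :
  solution_on f x0 +oo%E x -> 0 <= s ->
  solution_on f (x s) +oo%E (fun t => x (s + t)).
Proof.
move=> [x00 dx0 dx]; rewrite le_eqVlt => /predU1P[<-|s0].
  have -> : (fun t => x (0 + t)) = x by apply/funext => t; rewrite add0r.
  by split.
have dxs (t : R) : 0 <= t -> is_derive t 1 (fun t => x (s + t)) (f (x (s + t))).
  move=> t0; have [dst vst] := dx (s + t) (ltr_wpDr t0 s0) (ltry _).
  have E : (fun h => h^-1 *: (((fun t => x (s + t)) \o shift t) (h *: 1) - x (s + t))) =
           (fun h => h^-1 *: ((x \o shift (s + t)) (h *: 1) - x (s + t))).
    by apply/funext => h /=; rewrite addrCA.
  by split; rewrite /derivable/derive E.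
split => //; first by rewrite addr0.
- have [d v] := dxs 0 (lexx 0).
  move: d; rewrite /derivable => /cvg_ex[l dl].
  move: v; rewrite /derive (cvg_lim _ dl)// => lE; rewrite -lE.
  have := cvg_dnbhs_at_right dl.
  by under eq_fun do rewrite /= addr0 [_ *: 1]mulr1.
- by move=> t /ltW t0 _; exact: dxs.
Qed.

(** The supremum defining [tmax] is attained, so the choice made in [phi] picks a genuine solution
    on the whole maximal interval. *)
Lemma phi_solution (R : realType) (n : nat) (f : 'rV[R]_n -> 'rV[R]_n)
    (x0 : 'rV[R]_n) :
  locally_lipschitz f -> (0%:E < tmax f x0)%E ->
  solution_on f x0 (tmax f x0) (fun t => phi f t x0).
Proof.
move=> hf tm0.
suff : exists x, solution_on f x0 (tmax f x0) x by exact: xgetPex.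
(* Solutions on shorter intervals are glued along the diagonal [t |-> F t t]. *)
have /choice[F FP] : forall t : R, exists x : R -> 'rV[R]_n,
    (t%:E < tmax f x0)%E -> exists2 T, (t%:E < T)%E & solution_on f x0 T x.
  move=> t; case: (ltP t%:E (tmax f x0)) => [/ereal_sup_gt|_]; last by exists (cst 0).
  by move=> [T [_ [x sx]] tT]; exists x => _; exists T.
have FE s t : 0 <= s -> s <= t -> (t%:E < tmax f x0)%E -> F s s = F t s.
  move=> s0 st tT; have sT : (s%:E < tmax f x0)%E by rewrite (le_lt_trans _ tT)// lee_fin.
  have [T1 sT1 F1] := FP s sT; have [T2 tT2 F2] := FP t tT.
  by apply: (solution_unique hf F1 F2) => //; rewrite (le_lt_trans _ tT2)// lee_fin.
exists (fun t => F t t); split.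
- by have [T _ []] := FP 0 tm0.
- have [u u0 uT] := ereal_lt_between tm0.
  have [T uT' [F00 F0 _]] := FP u uT.
  rewrite (FE 0 u)// ?ltW//; apply: cvg_trans F0; apply: near_eq_cvg.
  near=> h; rewrite (FE h u)//; near: h; exact: nbhs_right_le.
(* For a fixed [u > t] the single solution [F u] agrees with the diagonal on a neighbourhood of [t],
   so the derivative carries over. *)
- move=> t t0 tT; have [u tu uT] := ereal_lt_between tT.
  have [T uT' [_ _ dF]] := FP u uT.
  rewrite (FE t u)// ?ltW//; apply: near_eq_is_derive (dF t t0 _); last first.
    by rewrite (lt_trans _ uT')// lte_fin.
  near=> s; rewrite (FE s u)//; apply/ltW; near: s.
    exact: lt_nbhsr.
  exact: lt_nbhsl.
Unshelve. all: by end_near. Qed.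

Lemma solution_tmax (R : realType) (n : nat) (f : 'rV[R]_n -> 'rV[R]_n)
    (x0 : 'rV[R]_n) (T : \bar R) (x : R -> 'rV[R]_n) :
  (0%:E < T)%E -> solution_on f x0 T x -> (T <= tmax f x0)%E.
Proof. by move=> T0 sx; apply: ereal_sup_ubound; split => //; exists x. Qed.

Lemma phi_unique (R : realType) (n : nat) (f : 'rV[R]_n -> 'rV[R]_n)
    (x0 : 'rV[R]_n) (T : \bar R) (x : R -> 'rV[R]_n) (t : R) :
  locally_lipschitz f -> solution_on f x0 T x -> 0 <= t -> (t%:E < T)%E ->
  phi f t x0 = x t.
Proof.
move=> hf sx t0 tT.
have T0 : (0%:E < T)%E by rewrite (le_lt_trans _ tT)// lee_fin.
have tm := solution_tmax T0 sx.
have sp := phi_solution hf (lt_le_trans T0 tm).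
by apply: (solution_unique hf sp sx) => //; exact: lt_le_trans tm.
Qed.

Lemma phi_shift (R : realType) (n : nat) (f : 'rV[R]_n -> 'rV[R]_n)
    (x0 : 'rV[R]_n) (s : R) :
  locally_lipschitz f -> tmax f x0 = +oo%E -> 0 <= s ->
  tmax f (phi f s x0) = +oo%E /\
  forall t, 0 <= t -> phi f t (phi f s x0) = phi f (s + t) x0.
Proof.
move=> hf tmy s0.
have sx : solution_on f x0 +oo%E (fun t => phi f t x0).
  by rewrite -tmy; apply: phi_solution => //; rewrite tmy ltry.
have ss := solution_shift sx s0; split.
  by apply/eqP; rewrite -leye_eq; exact: (solution_tmax (ltry 0) ss).
by move=> t t0; rewrite (phi_unique hf ss)// ltry.
Qed.

(** * First-order expansion of [V] on [S] and the chain rule *)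

Lemma dotvE (R : realType) (n : nat) (u v : 'rV[R]_n) :
  dotv u v = \sum_i u 0 i * v 0 i.
Proof. by rewrite /dotv mxE; apply: eq_bigr => i _; rewrite mxE. Qed.

Lemma dotv_norm_le (R : realType) (n : nat) (u v : 'rV[R]_n) :
  `|dotv u v| <= n%:R * `|u| * `|v|.
Proof.
rewrite dotvE (le_trans (ler_norm_sum _ _ _))//.
have -> : n%:R * `|u| * `|v| = \sum_(i < n) `|u| * `|v|.
  by rewrite sumr_const card_ord -mulrA mulr_natl.
by apply: ler_sum => i _; rewrite normrM ler_pM// ler_norm_coord.
Qed.

Lemma dotvBr (R : realType) (n : nat) (u v v' : 'rV[R]_n) :
  dotv u (v - v') = dotv u v - dotv u v'.
Proof. by rewrite /dotv linearB mulmxBr !mxE. Qed.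

Lemma dotvZr (R : realType) (n : nat) (u v : 'rV[R]_n) (a : R) :
  dotv u (a *: v) = a * dotv u v.
Proof. by rewrite /dotv linearZ -scalemxAr mxE. Qed.

(** Parametrising the segment by [s] in [[0, 1]] treats positive, negative and zero [h] at once. *)
Lemma MVT_partial (R : realType) (n : nat) (V : 'rV[R]_n -> R)
    (dV : 'rV[R]_n -> R) (z d : 'rV[R]_n) (h : R) :
  (forall s, 0 <= s <= 1 -> is_derive (z + (s * h) *: d) d V (dV (z + (s * h) *: d))) ->
  exists2 s, 0 <= s <= 1 & V (z + h *: d) - V z = h * dV (z + (s * h) *: d).
Proof.
move=> HdV; pose g (s : R) := V (z + (s * h) *: d).
have dg (s : R) : 0 <= s <= 1 -> is_derive s 1 g (h * dV (z + (s * h) *: d)).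
  move=> /HdV dVs; pose G (r : R) := V (z + r *: d).
  have dG : is_derive (s * h) 1 G (dV (z + (s * h) *: d)).
    have [dV1 dV2] := dVs.
    have E : (fun k => k^-1 *: ((G \o shift (s * h)) (k *: 1) - G (s * h))) =
        (fun k => k^-1 *: ((V \o shift (z + (s * h) *: d)) (k *: d) - V (z + (s * h) *: d))).
      apply/funext => k /=; rewrite /G [k *: 1]mulr1; congr (_ *: (V _ - _)).
      by rewrite scalerDl addrCA.
    by split; rewrite /derivable /derive E.
  have dm : is_derive s 1 (fun r : R => r * h) h.
    have -> : (fun r : R => r * h) = h *: (id : R -> R).
      by apply/funext => r; rewrite mulrC.
    by apply: is_derive_eq; rewrite /GRing.scale/= mulr1.
  by rewrite mulrC; exact: (@is_derive1_comp _ G (fun r => r * h) _ _ _ dG dm).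
have [s||s s01 gs] := @MVT_segment R g (fun s => h * dV (z + (s * h) *: d)) 0 1 ler01.
- by rewrite in_itv/= => /andP[/ltW s0 /ltW s1]; apply: dg; rewrite s0.
- by apply: derivable_within_continuous => s; rewrite in_itv/= => /dg[].
- exists s; first by move: s01; rewrite in_itv.
  by move: gs; rewrite /g mul1r mul0r scale0r addr0 subr0 mulr1.
Qed.

(** The classical fact that continuous partial derivatives imply differentiability. *)
Lemma C1_on_interior_expansion (R : realType) (n : nat) (D S : set 'rV[R]_n)
    (V : 'rV[R]_n -> R) (gradV : 'rV[R]_n -> 'rV[R]_n) (x : 'rV[R]_n) (e : R) :
  C1_on D S V gradV -> D x -> 0 < e ->
  \forall y \near nbhs x, `|V y - V x - dotv (gradV x) (y - x)| <= e * `|y - x|.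
Proof.
move=> [[_ oD] [DS _] dV cG _] Dx e0.
(* Each of the [n] coordinate steps may cost [d * |y - x|]; dividing by [n.+1] also covers
   [n = 0]. *)
pose d := e / n.+1%:R.
have d0 : 0 < d by rewrite divr_gt0.
have nd : n%:R * d <= e.
  by rewrite /d mulrCA ler_piMr ?(ltW e0)// ler_pdivrMr// mul1r ler_nat.
have : \forall z \near nbhs x, D z /\ `|gradV x - gradV z| <= d.
  apply: (@filterI _ (nbhs x)); first exact: open_nbhs_nbhs.
  have cGx : gradV z @[z --> x] --> gradV x.
    have : {within D, continuous gradV} by exact: continuous_subspaceW cG.
    by rewrite continuous_open_subspace// => /(_ x (mem_set Dx)).
  exact: (@cvgr_dist_le _ _ _ (nbhs x) _ gradV).
move=> /nbhs_ballP[r /= r0 Hr]; apply/nbhs_ballP; exists r => // y xy.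
have {}Hr z : `|z - x| <= `|y - x| -> D z /\ `|gradV x - gradV z| <= d.
  move=> zx; apply: Hr; rewrite -ball_normE/= distrC (le_lt_trans zx)//.
  by move: xy; rewrite -ball_normE/= distrC.
(* Telescope along the path from [x] to [y] that changes one coordinate at a time. *)
pose z k : 'rV[R]_n := \row_i (if (i < k)%N then y 0 i else x 0 i).
pose dl (k : 'I_n) : 'rV[R]_n := delta_mx 0 k.
have zS (k : 'I_n) : z k.+1 = z k + (y - x) 0 k *: dl k.
  apply/rowP => i; rewrite !mxE eqxx/=; have [->|ik] := eqVneq i k.
    by rewrite ltnSn ltnn mulr1 subrKC.
  by rewrite ltnS leq_eqVlt (inj_eq val_inj) (negPf ik) mulr0 addr0.
have zn : z n = y by apply/rowP => i; rewrite mxE ltn_ord.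
have z0 : z 0%N = x by apply/rowP => i; rewrite mxE.
(* In the sup norm the whole path stays as close to [x] as [y] is, hence inside the ball where
   [gradV] is controlled. *)
have zin (k : 'I_n) s : 0 <= s <= 1 ->
    `|z k + (s * (y - x) 0 k) *: dl k - x| <= `|y - x|.
  move=> /andP[s0 s1]; apply: ler_norm_rV => // i.
  apply: le_trans (ler_norm_coord _ i); rewrite !mxE eqxx/=.
  have [->|ik] := eqVneq i k.
    rewrite ltnn mulr1 addrAC subrr add0r normrM ger0_norm// ler_piMl//.
  by rewrite mulr0 addr0; case: ifP => // _; rewrite subrr normr0.
have step (k : 'I_n) :
    `|V (z k.+1) - V (z k) - gradV x 0 k * (y - x) 0 k| <= d * `|y - x|.
  have [s s01 Vs] := @MVT_partial R n V (fun w => gradV w 0 k) (z k) (dl k) ((y - x) 0 k)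
    (fun s s01 => dV _ (Hr _ (zin k s s01)).1 k).
  rewrite zS Vs mulrC -mulrBl normrM ler_pM// ?ler_norm_coord//.
  have [_] := Hr _ (zin k s s01); apply: le_trans.
  rewrite distrC.
  have := ler_norm_coord (gradV x - gradV (z k + (s * (y - x) 0 k) *: dl k)) k.
  by rewrite !mxE.
have -> : V y - V x - dotv (gradV x) (y - x) =
    \sum_(k < n) (V (z k.+1) - V (z k) - gradV x 0 k * (y - x) 0 k).
  rewrite sumrB dotvE; congr (_ - _).
  by rewrite -(big_mkord xpredT (fun k => V (z k.+1) - V (z k))) telescope_sumr// zn z0.
rewrite (le_trans (ler_norm_sum _ _ _))//.
apply: le_trans (_ : \sum_(k < n) d * `|y - x| <= _).
  by apply: ler_sum => k _; exact: step.
by rewrite sumr_const card_ord -mulr_natl mulrA ler_wpM2r.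
Qed.

Lemma C1_on_expansion (R : realType) (n : nat) (D S : set 'rV[R]_n)
    (V : 'rV[R]_n -> R) (gradV : 'rV[R]_n -> 'rV[R]_n) (x : 'rV[R]_n) (e : R) :
  C1_on D S V gradV -> S x -> 0 < e ->
  \forall y \near within S (nbhs x),
    `|V y - V x - dotv (gradV x) (y - x)| <= e * `|y - x|.
Proof.
move=> hV Sx e0; have [_ _ _ _ H] := hV.
have [Dx|nDx] := pselect (D x); last by apply: H.
by apply: cvg_within; exact: (C1_on_interior_expansion hV Dx e0).
Qed.

Lemma C1_on_cvg (R : realType) (n : nat) (D S : set 'rV[R]_n)
    (V : 'rV[R]_n -> R) (gradV : 'rV[R]_n -> 'rV[R]_n) (x : 'rV[R]_n) :
  C1_on D S V gradV -> S x -> V y @[y --> within S (nbhs x)] --> V x.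
Proof.
move=> hV Sx.
(* The expansion with error factor 1 gives [|V y - V x| <= c * |y - x|] near [x] within [S]. *)
pose c := n%:R * `|gradV x| + 1.
have c0 : 0 < c by rewrite ltr_wpDl// mulr_ge0.
apply/(@cvgrPdist_le _ _ _ (within S (nbhs x))) => e e0.
have near_dist : \forall y \near within S (nbhs x), `|y - x| <= e / c.
  apply: cvg_within.
  by apply: (@cvgr_distC_le _ _ _ (nbhs x) _ id) => //; exact: divr_gt0.
have := C1_on_expansion hV Sx (@ltr01 R).
apply: filterS2 near_dist => y yx Hy.
rewrite distrC -(subrK (dotv (gradV x) (y - x)) (V y - V x)).
rewrite (le_trans (ler_normD _ _))//.
apply: le_trans (_ : c * `|y - x| <= _); last by rewrite mulrC -ler_pdivlMr.
by rewrite /c mulrDl addrC lerD// dotv_norm_le.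
Qed.

(** The curve may run through points of [S] outside [D]. Only values of [V] along the curve enter
    the difference quotient, so the expansion within [S] suffices. *)
Lemma is_derive_C1_on_comp (R : realType) (n : nat) (D S : set 'rV[R]_n)
    (V : 'rV[R]_n -> R) (gradV : 'rV[R]_n -> 'rV[R]_n) (x : R -> 'rV[R]_n)
    (t : R) (v : 'rV[R]_n) :
  C1_on D S V gradV -> is_derive t 1 x v -> (\forall s \near t, S (x s)) ->
  is_derive t 1 (V \o x) (dotv (gradV (x t)) v).
Proof.
move=> hV dx Sx; have Sxt : S (x t) by exact: nbhs_singleton Sx.
have [dxt vE] := dx.
have cx : {for t, continuous x} by exact/differentiable_continuous/derivable1_diffP.
pose q (h : R) := h^-1 *: (x (h + t) - x t).
have qv : q h @[h --> 0^'] --> v.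
  move: dxt vE; rewrite /derivable /derive => /cvg_ex[l dl].
  rewrite (cvg_lim _ dl)// => <-.
  by move: dl; under eq_fun do rewrite /= [_ *: 1]mulr1.
suff H : h^-1 * (V (x (h + t)) - V (x t)) @[h --> 0^'] --> dotv (gradV (x t)) v.
  have E : (fun h => h^-1 *: (((V \o x) \o shift t) (h *: 1) - (V \o x) t)) =
      (fun h => h^-1 * (V (x (h + t)) - V (x t))).
    by apply/funext => h /=; rewrite [h *: 1]mulr1.
  split; rewrite /derivable /derive E; first by apply/cvg_ex; exists (dotv (gradV (x t)) v).
  exact: cvg_lim H.
apply/(@cvgrPdist_le _ _ _ 0^') => e e0.
pose p := gradV (x t).
pose c := n%:R * `|p| + 1.
have c0 : 0 < c by rewrite ltr_wpDl// mulr_ge0.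
(* Half of [e] goes to the remainder of the expansion, where [|q h| <= |v| + 1]; the other half goes
   to the linear term, via [c]. *)
pose d := e / 2 / (`|v| + 1).
have d0 : 0 < d by rewrite !divr_gt0// ltr_wpDl.
have q1 : \forall h \near 0^', `|v - q h| <= e / 2 / c.
  by apply: (@cvgr_dist_le _ _ _ 0^' _ q) => //; rewrite !divr_gt0.
have q2 : \forall h \near 0^', `|q h| <= `|v| + 1.
  apply: (@cvgr_norm_le _ _ _ 0^' _ q _ qv); rewrite ltrDl//.
have ht : h + t @[h --> 0^'] --> t.
  have : h + t @[h --> 0^'] --> 0 + t.
    by apply: cvgD; [apply: cvg_within_filter; exact: cvg_id | exact: cvg_cst].
  by rewrite add0r.
have tx : x (h + t) @[h --> 0^'] --> x t.
  exact: (@cvg_comp _ _ _ (fun h => h + t) x 0^' (nbhs t) (nbhs (x t)) ht cx).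
have Sh : \forall h \near 0^', S (x (h + t)) by exact: ht Sx.
have exp : \forall h \near 0^',
    `|V (x (h + t)) - V (x t) - dotv p (x (h + t) - x t)| <= d * `|x (h + t) - x t|.
  have := tx _ (C1_on_expansion hV Sxt d0).
  by apply: filterS2 Sh => h Sh; apply.
near=> h.
have -> : dotv p v - h^-1 * (V (x (h + t)) - V (x t)) = dotv p (v - q h) -
    h^-1 * (V (x (h + t)) - V (x t) - dotv p (x (h + t) - x t)).
  by rewrite /q (dotvBr p v) dotvZr; ring.
rewrite (le_trans (ler_normB _ _))// [leRHS]splitr lerD//.
  rewrite (le_trans (dotv_norm_le _ _))//.
  apply: le_trans (_ : c * `|v - q h| <= _).
    by rewrite ler_wpM2r// lerDl.
  by rewrite mulrC -ler_pdivlMr//; near: h.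
rewrite normrM; apply: le_trans (_ : d * `|q h| <= _).
  by rewrite /q normrZ mulrCA ler_wpM2l//; near: h.
apply: le_trans (_ : d * (`|v| + 1) <= _).
  by rewrite ler_wpM2l ?(ltW d0)//; near: h.
by rewrite /d divfK// gt_eqF// ltr_wpDl.
Unshelve. all: by end_near. Qed.

Lemma cvg_dotv (R : realType) (n : nat) (T : Type) (F : set_system T)
    (FF : Filter F) (u w : T -> 'rV[R]_n) (a b : 'rV[R]_n) :
  u k @[k --> F] --> a -> w k @[k --> F] --> b ->
  dotv (u k) (w k) @[k --> F] --> dotv a b.
Proof.
move=> ua wb; rewrite dotvE; under eq_fun do rewrite dotvE.
apply: (cvg_big add_continuous) => i _; apply: cvgM.
  exact: (cvg_comp _ _ ua (@coord_continuous _ _ _ _ _ _)).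
exact: (cvg_comp _ _ wb (@coord_continuous _ _ _ _ _ _)).
Qed.

(** * Monotone functions sampled at times tending to infinity *)

Lemma nonvanishing_sign (R : realType) (g : R -> R) (T : R) :
  (forall s, T < s -> {for s, continuous g}) -> (forall s, T < s -> g s != 0) ->
  (forall s, T < s -> 0 < g s) \/ (forall s, T < s -> g s < 0).
Proof.
move=> cg g0; have zero s t : T < s -> T < t -> 0 < g s -> g t < 0 -> False.
  move=> Ts Tt gs gt.
  have cw a b : T < a -> {within `[a, b], continuous g}.
    move=> Ta; apply: continuous_in_subspaceT => u /[!inE]/= /[!in_itv]/= /andP[au _].
    by apply: cg; exact: lt_le_trans au.
  have bounds : Num.min (g s) (g t) <= 0 <= Num.max (g s) (g t).
    by rewrite ge_min (ltW gt) orbT le_max (ltW gs).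
  have [st|ts] := leP s t.
    have [c] := IVT st (cw s t Ts) bounds.
    rewrite in_itv/= => /andP[sc _] /eqP; apply/negP/g0.
    exact: lt_le_trans sc.
  rewrite minC maxC in bounds.
  have [c] := IVT (ltW ts) (cw t s Tt) bounds.
  rewrite in_itv/= => /andP[tc _] /eqP; apply/negP/g0.
  exact: lt_le_trans tc.
have T1 : T < T + 1 by rewrite ltrDl.
have := g0 _ T1; rewrite neq_lt => /orP[g1|g1]; [right|left] => s Ts.
  by have := g0 _ Ts; rewrite neq_lt => /orP[//|gs]; case: (zero s (T + 1)).
by have := g0 _ Ts; rewrite neq_lt => /orP[gs|//]; case: (zero (T + 1) s).
Qed.

(** Monotonicity keeps [v] below its limit [c]. At a late [t k] the value exceeds [c - d * tau], and
    a further time [tau] adds at least [d * tau], which overshoots [c]. *)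
Lemma increasing_no_limit (R : realType) (v g : R -> R) (T c d tau : R)
    (t : R^nat) :
  (forall s, T < s -> is_derive s 1 v (g s)) -> (forall s, T < s -> 0 < g s) ->
  t @ \oo --> +oo -> v (t k) @[k --> \oo] --> c -> 0 < d -> 0 < tau ->
  (\forall k \near \oo, forall s, 0 <= s <= tau -> d <= g (t k + s)) -> False.
Proof.
move=> dv g0 ty vc d0 tau0 dg.
have mvt a b : T < a -> a <= b -> exists2 s, a <= s <= b & v b - v a = g s * (b - a).
  move=> Ta ab; have [s| |s sab vab] := @MVT_segment R v g a b ab.
  - by rewrite in_itv/= => /andP[as_ _]; apply: dv; exact: lt_trans as_.
  - apply: derivable_within_continuous => s; rewrite in_itv/= => /andP[as_ _].
    by have [] := dv s (lt_le_trans Ta as_).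
  - by exists s => //; move: sab; rewrite in_itv.
have vlec a : T < a -> v a <= c.
  move=> Ta; rewrite -(cvg_lim _ vc)//; apply: limr_ge; first by apply/cvg_ex; exists c.
  near=> k; have atk : a <= t k by near: k; move/cvgryPge : ty; exact.
  have [s /andP[as_ _] E] := mvt _ _ Ta atk.
  by rewrite -subr_ge0 E mulr_ge0// ?subr_ge0// ltW// g0// (lt_le_trans Ta).
have [k [[Tk vk] gk]] : exists k, (T < t k /\ c - d * tau < v (t k)) /\
    forall s, 0 <= s <= tau -> d <= g (t k + s).
  apply: (@filter_ex _ (nbhs \oo)); apply: filterI => //; apply: filterI.
    by move/cvgryPgt : ty; exact.
  by apply: (cvgr_gt _ vc); rewrite gtrBl mulr_gt0.
have [s /andP[s1 s2] E] := mvt (t k) (t k + tau) Tk (ltW (ltr_pwDr tau0 (lexx _))).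
have : d * tau <= v (t k + tau) - v (t k).
  rewrite E addrAC subrr add0r ler_wpM2r ?(ltW tau0)//.
  by rewrite -(subrKC (t k) s); apply: gk; rewrite subr_ge0 s1 lerBlDl.
have : v (t k + tau) <= c by apply: vlec; rewrite ltr_wpDr// ltW.
lra.
Unshelve. all: by end_near. Qed.

Lemma monotone_no_limit (R : realType) (v g : R -> R) (T c d tau : R)
    (t : R^nat) :
  (forall s, T < s -> is_derive s 1 v (g s)) ->
  (forall s, T < s -> {for s, continuous g}) -> (forall s, T < s -> g s != 0) ->
  t @ \oo --> +oo -> v (t k) @[k --> \oo] --> c -> 0 < d -> 0 < tau ->
  (\forall k \near \oo, forall s, 0 <= s <= tau -> d <= `|g (t k + s)|) -> False.
Proof.
move=> dv cg g0 ty vc d0 tau0 dg.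
have Tt : \forall k \near \oo, T < t k by move/cvgryPgt : ty; exact.
have [gp|gn] := nonvanishing_sign cg g0.
  apply: (increasing_no_limit dv gp ty vc d0 tau0); apply: filterS2 Tt dg => k Tk H s s0.
  by rewrite -[leRHS]gtr0_norm ?H// gp// ltr_wpDr//; case/andP: s0.
apply: (@increasing_no_limit _ (- v) (fun s => - g s) T (- c) d tau t) => //.
- by move=> s /dv dvs; apply: is_deriveN.
- by move=> s /gn; rewrite oppr_gt0.
- exact: cvgN.
- apply: filterS2 Tt dg => k Tk H s s0.
  by rewrite -[leRHS]ltr0_norm ?H// gn// ltr_wpDr//; case/andP: s0.
Qed.

(** The mean value theorem is applied to each coordinate; with the sup norm the different
    intermediate times cost no constant. *)
Lemma solution_speed (R : realType) (n : nat) (f : 'rV[R]_n -> 'rV[R]_n)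
    (x : R -> 'rV[R]_n) (a b M : R) :
  (forall s, a <= s <= b -> is_derive s 1 x (f (x s))) ->
  (forall s, a <= s <= b -> `|f (x s)| <= M) -> a <= b ->
  `|x b - x a| <= M * (b - a).
Proof.
move=> dx fM ab; have M0 : 0 <= M by apply: le_trans (fM a _); rewrite ?lexx.
apply: ler_norm_rV => [|i]; first by rewrite mulr_ge0// subr_ge0.
have dxi s : a <= s <= b -> is_derive s 1 (fun s => x s 0 i) (f (x s) 0 i).
  by move=> /dx; exact: is_derive_coord.
have [s| |s sab E] := @MVT_segment R (fun s => x s 0 i) (fun s => f (x s) 0 i) a b ab.
- by rewrite in_itv/= => /andP[/ltW as_ /ltW sb]; apply: dxi; rewrite as_.
- by apply: derivable_within_continuous => s; rewrite in_itv/= => /dxi[].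
- rewrite !mxE E normrM (ger0_norm (_ : 0 <= b - a)) ?subr_ge0// ler_wpM2r ?subr_ge0//.
  by rewrite (le_trans (ler_norm_coord _ _))// fM// -in_itv.
Qed.

Lemma cvg_to_within (T : Type) (U : topologicalType) (F : set_system T)
    (FF : Filter F) (u : T -> U) (a : U) (S : set U) :
  u k @[k --> F] --> a -> (\forall k \near F, S (u k)) ->
  u k @[k --> F] --> within S (nbhs a).
Proof. by move=> ua Su P /ua; apply: filterS2 Su => k Sk; apply. Qed.

(** * Omega-limit sets: location and invariance *)

Section omega.
Variables (R : realType) (n : nat) (f : 'rV[R]_n -> 'rV[R]_n).
Hypothesis hf : locally_lipschitz f.
Variable Omega : set 'rV[R]_n.
Hypothesis cOmega : compact Omega.
Hypothesis invOmega : positively_invariant f Omega.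

Lemma omega_tmax x0 y : omega_limit_set f x0 y -> tmax f x0 = +oo%E.
Proof.
move=> [t [tT ty _]]; case E : (tmax f x0) => [r|//|].
  have [k] : exists k, r < t k.
    by apply: (@filter_ex _ (nbhs \oo)); move/cvgryPgt : ty; exact.
  by have [_] := tT k; rewrite E lte_fin => /lt_trans/[apply]; rewrite ltxx.
by have [_] := tT 0%N; rewrite E.
Qed.

Lemma omega_sub x0 : Omega x0 -> omega_limit_set f x0 `<=` Omega.
Proof.
move=> Ox0 y [t [tT ty ly]].
have clOmega : closed Omega by apply: compact_closed => //; exact: norm_hausdorff.
apply: (closed_cvg _ clOmega _ _ ly); apply: nearW => k.
by have [t0 tk] := tT k; apply: invOmega.2.
Qed.

Lemma phi_is_derive x0 (t : R) : tmax f x0 = +oo%E -> 0 < t ->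
  is_derive t 1 (fun s => phi f s x0) (f (phi f t x0)).
Proof.
move=> tmy t0; have [|_ _] := @phi_solution _ _ f x0 hf; first by rewrite tmy ltry.
by apply => //; rewrite tmy ltry.
Qed.

Lemma omega_closure x0 (A D S : set 'rV[R]_n) (V : 'rV[R]_n -> R)
    (gradV : 'rV[R]_n -> 'rV[R]_n) :
  C1_on D S V gradV -> Omega `\` A `<=` S ->
  (forall x, (Omega `\` A) x -> dotv (gradV x) (f x) != 0) ->
  negatively_invariant f A -> Omega x0 ->
  omega_limit_set f x0 `<=` closure A.
Proof.
move=> hV hS hi [_ hA] Ox0 y wy; apply: contrapT => nAy.
have tmy := omega_tmax wy; have Oy := omega_sub Ox0 wy.
have [t [tT ty ly]] := wy; pose x (s : R) := phi f s x0.
(* Otherwise every [s >= 0] is followed by a visit to [A], negative invariance puts [x s] in [A],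
   and [y] is a limit of points of [A]. *)
have [T [T0 TA]] : exists T, 0 <= T /\ forall s, T < s -> ~ A (x s).
  apply: contrapT => H; apply: nAy.
  have Ax s : 0 <= s -> A (x s).
    move=> s0; apply: contrapT => nAs; apply: H; exists s; split => // u su Au.
    have [tms xs] := phi_shift hf tmy s0.
    apply: nAs; apply: (hA _ (u - s)); rewrite ?tms ?ltry ?subr_ge0 ?(ltW su)//.
    by rewrite xs ?subr_ge0 ?(ltW su)// subrKC.
  move=> B By; have [k Bk] := @filter_ex _ (nbhs \oo) _ _ (ly _ By).
  by exists (x (t k)); split => //; apply: Ax; have [] := tT k.
have Ox s : 0 <= s -> Omega (x s) by move=> s0; apply: invOmega.2; rewrite ?tmy ?ltry.
have OAx s : T < s -> (Omega `\` A) (x s).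
  by move=> Ts; split; [apply: Ox; rewrite (le_trans T0)// ltW | exact: TA].
have OAy : (Omega `\` A) y by split=> // /subset_closure.
have Sy := hS _ OAy.
pose g z := dotv (gradV z) (f z).
have cf := locally_lipschitz_continuous hf.
have cg z : S z -> g w @[w --> within S (nbhs z)] --> g z.
  move=> Sz; apply: cvg_dotv; last by apply: cvg_within_filter; exact: cf.
  have [_ _ _ cG _] := hV.
  exact: ((@subspace_continuousP _ S _ gradV).1 cG z Sz).
have dx (s : R) : T < s -> is_derive s 1 x (f (x s)).
  by move=> Ts; apply: phi_is_derive => //; exact: le_lt_trans Ts.
have nearS (s : R) : T < s -> \forall u \near s, S (x u).
  move=> Ts; near=> u; apply/hS/OAx; near: u; exact: lt_nbhsr.
have gy0 : 0 < `|g y| by rewrite normr_gt0; exact: hi.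
(* Continuity of [g] at [y] within [S] keeps [|g|] above half of [|g y|]. *)
have [r r0 Hr] : exists2 r, 0 < r & forall z, S z -> `|y - z| < r -> `|g y| / 2 <= `|g z|.
  have : \forall z \near within S (nbhs y), `|g y - g z| <= `|g y| / 2.
    by apply: (@cvgr_dist_le _ _ _ (within S (nbhs y)) _ g) => //; [exact: cg|exact: divr_gt0].
  rewrite /within/= => /nbhs_ballP[r /= r0 Hr]; exists r => // z Sz yz.
  have := Hr z; rewrite -ball_normE/= => /(_ yz Sz) gz.
  have := ler_normD (g y - g z) (g z); rewrite subrK; lra.
have [M M0 fM] : exists2 M, 0 < M & forall z, Omega z -> `|f z| <= M.
  have /compact_bounded[M [_ HM]] : compact (f @` Omega).
    by apply: continuous_compact => //; exact: continuous_subspaceT.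
  exists (`|M| + 1) => [|z Oz]; first by rewrite ltr_wpDl.
  by apply: (HM (`|M| + 1)); [rewrite (le_lt_trans (ler_norm M))// ltrDl | exists z].
have near1 : \forall k \near \oo, T < t k by move/cvgryPgt : ty; exact.
(* At speed at most [M] the trajectory moves at most [r / 2] in time [tau], so from within [r / 2]
   of [y] it stays in the ball of radius [r]. *)
pose tau := r / 2 / M.
apply: (@monotone_no_limit _ (V \o x) (g \o x) T (V y) (`|g y| / 2) tau t) => //.
- by move=> s Ts; apply: is_derive_C1_on_comp hV (dx s Ts) (nearS s Ts).
- move=> s Ts; apply: (cvg_comp _ _ _ (cg _ (nbhs_singleton (nearS s Ts)))).
  apply: cvg_to_within (nearS s Ts) => //.
  by apply/differentiable_continuous/derivable1_diffP; have [] := dx s Ts.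
- by move=> s Ts; apply: hi; exact: OAx.
- apply: (cvg_comp _ _ _ (C1_on_cvg hV Sy)); apply: cvg_to_within ly _.
  by apply: filterS near1 => k Tk; exact/hS/OAx.
- exact: divr_gt0.
- by rewrite !divr_gt0.
- have near2 : \forall k \near \oo, `|y - x (t k)| < r / 2.
    by apply: (@cvgr_dist_lt _ _ _ (nbhs \oo) _ (x \o t) y ly); exact: divr_gt0.
  apply: filterS2 near1 near2 => k Tk yk s /andP[s0 st].
  have Tks : T < t k + s by rewrite ltr_wpDr.
  apply: Hr; first exact/hS/OAx.
  have speed : `|x (t k + s) - x (t k)| <= M * s.
    rewrite -[s in leRHS](addrK (t k)) (addrC s).
    apply: (@solution_speed _ _ f) => [u /andP[tu _]|u /andP[tu _]|]; last by rewrite lerDl.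
      by apply: dx; exact: lt_le_trans tu.
    by apply: fM; apply: (OAx _ _).1; exact: lt_le_trans tu.
  have : M * s <= r / 2 by rewrite mulrC -ler_pdivlMr.
  have := ler_normD (y - x (t k)) (x (t k) - x (t k + s)).
  rewrite subrKA (distrC (x (t k))).
  lra.
Unshelve. all: by end_near. Qed.

Lemma phi0 x0 : (0%:E < tmax f x0)%E -> phi f 0 x0 = x0.
Proof. by move=> /(phi_solution hf)[]. Qed.

(** One constant serves all starting points [p] in [Omega]. The arc of [y] is joined to [Omega]
    because, for negative invariance, only the end point of that arc is known to be a limit
    point. *)
Lemma phi_gronwall y (s : R) : 0 <= s -> (s%:E < tmax f y)%E ->
  exists2 C, 0 < C & forall p, Omega p -> tmax f p = +oo%E ->
    {in `[0, s] &, forall u v,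
      `|phi f v p - phi f v y| <= C * `|phi f u p - phi f u y|}.
Proof.
move=> s0 sT; have T0 : (0%:E < tmax f y)%E by rewrite (le_lt_trans _ sT)// lee_fin.
have sy := phi_solution hf T0.
have cy := solution_within_continuous sy s0 sT.
pose K := Omega `|` (fun u => phi f u y) @` `[0, s].
have cK : compact K.
  by apply: compactU => //; apply: continuous_compact => //; exact: segment_compact.
have [L /ltW L0 fL] := locally_lipschitz_compact hf cK.
have [C C0 HC] := gronwall s L0 fL; exists C => // p Op tp.
have sp : solution_on f p +oo%E (fun u => phi f u p).
  by rewrite -tp; apply: phi_solution => //; rewrite tp ltry.
have cp := solution_within_continuous sp s0 (ltry s).
apply: (HC _ _ _ _ (subr0 s) cp cy).
- by move=> u; rewrite in_itv/= => /andP[u0 _]; exact: phi_is_derive.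
- move=> u; rewrite in_itv/= => /andP[u0 us]; have [_ _] := sy; apply=> //.
  by rewrite (lt_trans _ sT)// lte_fin.
- move=> u us; split; last by right; exists u.
  by left; apply: invOmega.2; rewrite ?tp ?ltry//; move: us; rewrite in_itv/= => /andP[].
Qed.

(** The times are shifted by [s]; as the Gronwall constant does not depend on [k], convergence at
    [t k] passes to [t k + s]. *)
Lemma omega_positively_invariant x0 : Omega x0 -> omega_limit_set f x0 !=set0 ->
  positively_invariant f (omega_limit_set f x0).
Proof.
move=> Ox0 w0; split => // y s wy s0 sT.
have tmy := omega_tmax wy; have [t [tT ty ly]] := wy.
have [C C0 HC] := phi_gronwall s0 sT.
exists (fun k => t k + s); split.
- by move=> k; rewrite tmy ltry addr_ge0//; have [] := tT k.
- apply: (@ger_cvgy _ (nbhs \oo) _ R t (fun k => t k + s)) => //.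
  by apply: nearW => k; rewrite lerDl.
- apply/(@cvgrPdist_le _ _ _ (nbhs \oo)) => e e0.
  have near_y : \forall k \near \oo, `|y - phi f (t k) x0| <= e / C.
    by apply: (@cvgr_dist_le _ _ _ (nbhs \oo) _ _ _ ly); exact: divr_gt0.
  apply: filterS near_y => k Hk; have tk0 := (tT k).1.
  have [tmk phik] := phi_shift hf tmy tk0.
  have Ok : Omega (phi f (t k) x0) by apply: invOmega.2 => //; exact: (tT k).2.
  have := HC _ Ok tmk 0 s; rewrite !in_itv/= !lexx s0 => /(_ isT isT).
  rewrite (phik s)// !phi0 ?tmk ?ltry//; last by rewrite (le_lt_trans _ sT)// lee_fin.
  rewrite distrC => /le_trans; apply.
  by rewrite mulrC -ler_pdivlMr// distrC.
Qed.

(* Gronwall backwards from time [s] replaces the existence of solutions in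
   negative time. *)
Lemma omega_negatively_invariant x0 : Omega x0 -> omega_limit_set f x0 !=set0 ->
  negatively_invariant f (omega_limit_set f x0).
Proof.
move=> Ox0 w0; split => // z s s0 sT wy.
have tmy := omega_tmax wy; have [t [tT ty ly]] := wy.
have [C C0 HC] := phi_gronwall s0 sT.
have ts : \forall k \near \oo, s <= t k by move/cvgryPge : ty; exact.
(* The maximum keeps all times nonnegative; it equals [t k - s] for all large [k]. *)
exists (fun k => Num.max 0 (t k - s)); split.
- by move=> k; rewrite tmy ltry le_max lexx.
- apply/cvgryPge => A; have : \forall k \near \oo, A + s <= t k by move/cvgryPge : ty; exact.
  by apply: filterS => k; rewrite -lerBrDr le_max => ->; rewrite orbT.
- apply/(@cvgrPdist_le _ _ _ (nbhs \oo)) => e e0.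
  have near_y : \forall k \near \oo, `|phi f s z - phi f (t k) x0| <= e / C.
    by apply: (@cvgr_dist_le _ _ _ (nbhs \oo) _ _ _ ly); exact: divr_gt0.
  apply: filterS2 ts near_y => k stk Hk; have tk0 : 0 <= t k - s by rewrite subr_ge0.
  rewrite (max_idPr tk0).
  have [tmk phik] := phi_shift hf tmy tk0.
  have Ok : Omega (phi f (t k - s) x0) by apply: invOmega.2; rewrite ?tmy ?ltry.
  have := HC _ Ok tmk s 0; rewrite !in_itv/= !lexx s0 => /(_ isT isT).
  rewrite (phik s)// !phi0 ?tmk ?ltry//; last by rewrite (le_lt_trans _ sT)// lee_fin.
  rewrite distrC subrK => /le_trans; apply.
  by rewrite mulrC -ler_pdivlMr// distrC.
Qed.

End omega.

Unset Implicit Arguments.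

Theorem theorem1 (R : realType) (n : nat) (f : 'rV[R]_n -> 'rV[R]_n)
    (hf : locally_lipschitz f)
    (Omega : set 'rV[R]_n) (hOmega_compact : compact Omega)
    (hOmega_inv : positively_invariant f Omega)
    (A : set 'rV[R]_n) (hA : A !=set0)
    (D S : set 'rV[R]_n) (V : 'rV[R]_n -> R) (gradV : 'rV[R]_n -> 'rV[R]_n)
    (hV : C1_on D S V gradV) (hS : Omega `\` A `<=` S)
    (hi : forall x, (Omega `\` A) x -> dotv (gradV x) (f x) != 0)
    (hii : negatively_invariant f A) :
  forall x0, Omega x0 ->
    omega_limit_set f x0 `<=` largest_invariant_set f (closure A `&` Omega).
Proof.
move=> x0 Ox0 y wy; have w0 : omega_limit_set f x0 !=set0 by exists y.
(* The limit set is itself one of the invariant sets in the union; [y] makes it non-empty, as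
   invariance requires. *)
exists (omega_limit_set f x0) => //; split.
  by split; [exact: omega_positively_invariant hOmega_inv _ _ _|
             exact: omega_negatively_invariant hOmega_inv _ _ _].
move=> z wz; split; last exact: (omega_sub hOmega_compact hOmega_inv Ox0 wz).
exact: (omega_closure hf hOmega_compact hOmega_inv hV hS hi hii Ox0 wz).
Qed.
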